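(* Let $\mathbb{K}$ be a field of characteristic zero. Let $m,k\geq 1$ be integers and let $r$ be an integer with $$r\geq k\left(k(m+1)+\frac{(m-1)(k-1)}{2}\right)=\frac{k}{2}(3km+k-m+1).$$ Then there exists a nonempty Zariski open subset $U_{k,m,r}\subseteq\mathbb{K}[z]^0_{\leq r}$ such that, for every $\sigma\in U_{k,m,r}$ and every $k$-tuple of nonzero, pairwise distinct polynomials $p_1,\ldots,p_k\in\mathbb{K}[t]^0_{\leq m}$, the polynomials $\sigma(p_1),\ldots,\sigma(p_k)$ are linearly independent over $\mathbb{K}$.
   Context: $\mathbb{K}[t]^0_{\leq m}$ denotes the $\mathbb{K}$-vector space of polynomials $p\in\mathbb{K}[t]$ of degree at most $m$ with $p(0)=0$; similarly $\mathbb{K}[z]^0_{\leq r}$ is the space of polynomials $\sigma\in\mathbb{K}[z]$ of degree at most $r$ with $\sigma(0)=0$, identified with the affine space $\mathbb{K}^{r}$ of coefficients with its Zariski topology. $\sigma(p)$ denotes the composition $\sigma(p(t))$. *)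

(* Defs.v *)
From mathcomp Require Import all_boot all_order all_algebra.
From mathcomp Require Import mpoly.

Set Implicit Arguments.
Unset Strict Implicit.
Unset Printing Implicit Defensive.

Import GRing.Theory.
Local Open Scope ring_scope.

(* K[t]^0_{<= m}; recall that [size p] is the degree plus one (0 for p = 0). *)
Definition poly0_le (K : fieldType) (m : nat) : pred {poly K} :=
  [pred p : {poly K} | (size p <= m.+1)%N && (p.[0] == 0)].
Arguments poly0_le : clear implicits.

(* A subset of the affine space K^n is open when it is the complement of the
   common zero locus of a (possibly infinite) set S of polynomials. *)
Definition zariski_open (K : fieldType) (n : nat)
    (U : ('I_n -> K) -> Prop) : Prop :=
  exists S : {mpoly K[n]} -> Prop,
    forall v : 'I_n -> K, U v <-> (exists2 f, S f & f.@[v] != 0).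

(* The identification K^r ~ K[z]^0_{<= r}: coordinate i (counted from 0) is the
   coefficient of degree i + 1. *)
Definition poly0_of_coefs (K : fieldType) (r : nat) (a : 'I_r -> K) :
    {poly K} :=
  \sum_(i < r) a i *: 'X^(i.+1).

Definition zariski_open_poly0 (K : fieldType) (r : nat)
    (U : {poly K} -> Prop) : Prop :=
  (forall s : {poly K}, U s -> s \in poly0_le K r) /\
  zariski_open (fun a : 'I_r -> K => U (poly0_of_coefs a)).

(* The library's [free] requires a finite-dimensional ambient space, which
   {poly K} is not. *)
Definition lin_indep (K : fieldType) (V : lmodType K) (k : nat)
    (v : 'I_k -> V) : Prop :=
  forall c : 'I_k -> K, \sum_(i < k) c i *: v i = 0 -> forall i, c i = 0.

(* Main.v *)
Require Import Defs.
From mathcomp Require Import all_boot all_order all_algebra.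
From mathcomp Require Import mpoly.

Import GRing.Theory.
Local Open Scope ring_scope.

Set Implicit Arguments.
Unset Strict Implicit.

(** Call sigma bad when sum_i c_i sigma(p_i) = 0 for some nonzero, pairwise
    distinct p_1, ..., p_k of degree at most m with p_i(0) = 0 and some scalars
    c_i, not all 0.  It suffices to find one nonzero polynomial F in the r
    coefficients of sigma that vanishes on all bad sigma: U is then the locus
    where F is nonzero, which is nonempty because K is infinite
    ([mpoly_nonroot]).

    For fixed c and p, the relation is linear in sigma: it says that sigma is
    in the left kernel of the matrix A whose j-th row lists the coefficients
    of q_j = sum_i c_i p_i^j.  Dividing c by a nonzero coordinate leaves
    k - 1 + km parameters for the pair (c, p), so the bad sigma form a set of
    dimension less than r as soon as A always has rank at least
    S = k(m + 1).

    The rank bound is t-adic.  The p_i are the roots of a monic polynomial of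
    degree k in z that reduces to z^k modulo t, because all p_i vanish at 0;
    hence every q_(n+k) is a combination of q_n, ..., q_(n+k-1) with
    coefficients divisible by t.  If each of k consecutive q_j were in the
    span of the later ones, then, by induction on J, every q_b from there on
    would be divisible by t^J for all J, hence zero; the p_i being distinct
    and nonzero, this would give c = 0 ([power_sums_span]).  So each of the S
    disjoint blocks of k consecutive indices, for which kS <= r leaves room,
    contains a row outside the span of the later rows, and such rows are
    independent ([comb_mx_rank]).

    The dimension count is made explicit.  Where a given S x S minor of A is
    nonzero, Cramer's rule expresses S coordinates of sigma as rational
    functions of the other coordinates, of c and of p, with that minor as
    common denominator.  This presents the bad sigma as values of r rational
    functions in fewer than r variables, and such functions satisfy a
    polynomial relation F ([mpoly_implicitization]).  The final F is the
    product of these relations over the finitely many choices of a minor and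
    of a normalised coordinate of c. *)

(** * Multivariate polynomials: nonvanishing and algebraic relations *)

(** Uniqueness of the expansion of a natural number in base d. *)
Lemma digits_inj (d n : nat) (m m' : 'I_n -> nat) :
    (forall i, m i < d)%N -> (forall i, m' i < d)%N ->
  (\sum_i m i * d ^ i = \sum_i m' i * d ^ i)%N -> m =1 m'.
Proof.
elim: n m m' => [|n IHn] m m' lt_m lt_m' eq_mm'; first by case.
have shift (f : 'I_n.+1 -> nat) :
    (\sum_i f i * d ^ i = (\sum_i f (lift ord0 i) * d ^ i) * d + f ord0)%N.
  rewrite big_ord_recl expn0 muln1 addnC big_distrl; congr (_ + _)%N.
  by apply: eq_bigr => i _; rewrite /= /bump expnSr mulnA.
have d_gt0 : (0 < d)%N by apply: leq_ltn_trans (lt_m ord0).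
move: eq_mm'; rewrite !shift => eq_mm'.
have eq0 : m ord0 = m' ord0.
  by have := congr1 (modn^~ d) eq_mm'; rewrite !modnMDl !modn_small.
move: eq_mm'; rewrite eq0 => /addIn/eqP; rewrite eqn_pmul2r // => /eqP eqS.
move=> i; case: (unliftP ord0 i) => [j|] ->{i} //.
by apply: (IHn (fun j => m (lift ord0 j)) (fun j => m' (lift ord0 j))).
Qed.

Lemma poly_nonroot (K : fieldType) (q : {poly K}) :
  [pchar K] =i pred0 -> q != 0 -> exists x, q.[x] != 0.
Proof.
move=> charK0 nz_q; pose s : seq K := [seq i%:R | i <- iota 0 (size q)].
have [/allP roots_s | /allPn [x _ qx]] := boolP (all (root q) s); last by exists x.
have uniq_s : uniq s; last first.
  have := max_poly_roots nz_q (introT allP roots_s) uniq_s.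
  by rewrite size_map size_iota ltnn.
rewrite map_inj_uniq ?iota_uniq // => i j.
wlog le_ij : i j / (i <= j)%N.
  by move=> IH; have [/IH//|/ltnW/IH sym_ij /esym/sym_ij] := leqP i j.
move/esym/eqP; rewrite -subr_eq0 -natrB //.
move/pcharf0P: charK0 => ->; rewrite subn_eq0 => le_ji.
by apply/eqP; rewrite eqn_leq le_ij.
Qed.

(** Kronecker's substitution: evaluating the i-th variable at x^(d^i), with d
    above all exponents of F, sends distinct monomials of F to distinct powers
    of x, which reduces the claim to one variable. *)
Lemma mpoly_nonroot (K : fieldType) (n : nat) (F : {mpoly K[n]}) :
  [pchar K] =i pred0 -> F != 0 -> exists v, F.@[v] != 0.
Proof.
move=> charK0 nz_F; pose d := msize F.
pose code (m : 'X_{1..n}) := (\sum_(i < n) m i * d ^ i)%N.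
have lt_d (m : 'X_{1..n}) i : m \in msupp F -> (m i < d)%N.
  move=> /msize_mdeg_lt; apply: leq_ltn_trans.
  by rewrite mdegE (bigD1 i) //= leq_addr.
have code_inj : {in msupp F &, injective code}.
  move=> m m' Fm Fm' eq_code; apply/mnmP => i.
  by apply: (digits_inj (d := d) (m := m) (m' := m')) => // j; apply: lt_d.
pose q : {poly K} := \sum_(m <- msupp F) F@_m *: 'X^(code m).
have [||x qx] := poly_nonroot (q := q) => //.
  apply: contra_neq nz_F => q0; apply/mpolyP => m; rewrite mcoeff0.
  apply/eqP; rewrite mcoeff_eq0; apply/negP => Fm.
  have /eqP := congr1 (coefp (code m)) q0.
  rewrite /= /q coef_sum coef0 (bigD1_seq m) ?msupp_uniq //= big_seq_cond big1 ?addr0.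
    by rewrite coefZ coefXn eqxx mulr1; apply/negP; rewrite mcoeff_eq0 negbK.
  move=> m' /andP[Fm' neq_m']; rewrite coefZ coefXn.
  by rewrite (inj_in_eq code_inj) // eq_sym (negPf neq_m') mulr0.
exists (fun i : 'I_n => x ^+ (d ^ i)); apply: contraNneq qx.
rewrite mevalE => F0; apply/eqP; rewrite -[RHS]F0 /q horner_sum.
apply: eq_bigr => m _.
rewrite hornerZ hornerXn /code expr_sum; congr (_ * _).
by apply: eq_bigr => i _; rewrite -exprM mulnC.
Qed.

Lemma msizeM_leq (R : idomainType) (n a b : nat) (p q : {mpoly R[n]}) :
  (msize p <= a.+1)%N -> (msize q <= b.+1)%N -> (msize (p * q) <= (a + b).+1)%N.
Proof.
have [->|nz_p] := eqVneq p 0; first by rewrite mul0r msize0.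
have [->|nz_q] := eqVneq q 0; first by rewrite mulr0 msize0.
rewrite msizeM // => le_p le_q; rewrite -subn1 leq_subLR add1n -addSn -addnS.
exact: leq_add.
Qed.

Lemma msizeX_leq (R : idomainType) (n a e : nat) (p : {mpoly R[n]}) :
  (msize p <= a.+1)%N -> (msize (p ^+ e) <= (e * a).+1)%N.
Proof.
move=> le_p; elim: e => [|e IHe]; last by rewrite exprS mulSn msizeM_leq.
by rewrite expr0 msizeC; case: eqP.
Qed.

(** Any r rational functions G_j / D in N < r variables are algebraically
    dependent.  The products of the (G_j / D)^(al_j), with all al_j < d, become
    polynomials of degree O(d) once multiplied by D^(rd).  There are d^r of
    them, in a space of dimension O(d^N), so they are linearly dependent for
    large d, and the coefficients of the dependence are those of F. *)
Lemma mpoly_implicitization (K : fieldType) (N r : nat)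
    (G : 'I_r -> {mpoly K[N]}) (D : {mpoly K[N]}) :
    (N < r)%N ->
  exists2 F : {mpoly K[r]}, F != 0 &
    forall (y : 'I_N -> K) (x : 'I_r -> K), D.@[y] != 0 ->
      (forall j, D.@[y] * x j = (G j).@[y]) -> F.@[x] = 0.
Proof.
move=> lt_Nr; pose delta := (msize D + \sum_j msize (G j))%N.
(* The degrees will be below d * E, and d > E ^ N makes (d * E) ^ N < d ^ r. *)
pose E := (r * delta).+1; pose d := (E ^ N).+1.
pose H (al : {ffun 'I_r -> 'I_d}) : {mpoly K[N]} :=
  \prod_j (G j ^+ al j * D ^+ (d - al j)).
have sz_H al : (msize (H al) <= d * E)%N.
  suff: (msize (H al) <= (r * (d * delta)).+1)%N.
    by move/leq_trans; apply; rewrite mulnCA /E mulnS -addn1 addnC leq_add2r.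
  rewrite -[X in (X * _)%N](card_ord r) -sum_nat_const.
  rewrite /H; elim/big_ind2: _ => [|s a t b|j _].
  - by rewrite msizeC; case: eqP.
  - by move=> ? ?; apply: msizeM_leq.
  have szG : (msize (G j) <= delta.+1)%N.
    by rewrite leqW // /delta (bigD1 j) //= addnCA leq_addr.
  have szD : (msize D <= delta.+1)%N by rewrite leqW // leq_addr.
  rewrite -[X in (X * _)%N](subnKC (ltnW (ltn_ord (al j)))) mulnDl.
  by rewrite msizeM_leq ?msizeX_leq.
pose A : 'M[K]_(#|{ffun 'I_r -> 'I_d}|, #|{ffun 'I_N -> 'I_(d * E)}|) :=
  \matrix_(a, b)
    let be : {ffun 'I_N -> 'I_(d * E)} := enum_val b in
    (H (enum_val a))@_[multinom (be i : nat) | i < N].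
have : (0 < \rank (kermx A))%N.
  rewrite mxrank_ker subn_gt0; apply: leq_ltn_trans (rank_leq_col A) _.
  rewrite !card_ffun !card_ord expnMn.
  have: (d ^ N * E ^ N < d ^ N * d)%N by rewrite ltn_pmul2l ?expn_gt0.
  by move/leq_trans; apply; rewrite -expnSr leq_exp2l // ltnS expn_gt0.
rewrite lt0n mxrank_eq0 => /rowV0Pn [u /sub_kermxP uA nz_u].
pose mn (al : {ffun 'I_r -> 'I_d}) := [multinom (al i : nat) | i < r].
have mn_inj : injective mn.
  move=> al be /mnmP eq_ab; apply/ffunP => i; apply: val_inj.
  by have := eq_ab i; rewrite !mnmE.
pose F : {mpoly K[r]} := \sum_a u 0 a *: 'X_[mn (enum_val a)].
have sumH : \sum_a u 0 a *: H (enum_val a) = 0.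
  apply/mpolyP => m; rewrite mcoeff0 raddf_sum /=.
  have [/forallP lt_m | /forallPn [i]] := boolP [forall i, m i < d * E]%N.
    pose b := [ffun i => Ordinal (lt_m i)].
    have := congr1 (fun M : 'rV__ => M 0 (enum_rank b)) uA.
    rewrite !mxE => uAb; rewrite -[RHS]uAb; apply: eq_bigr => a _.
    rewrite mcoeffZ mxE enum_rankK; congr (_ * _@_ _).
    by apply/mnmP => i; rewrite mnmE ffunE.
  rewrite -leqNgt => le_mi; apply: big1 => a _; rewrite mcoeffZ.
  rewrite memN_msupp_eq0 ?mulr0 // msize_mdeg_ge //.
  apply: leq_trans (sz_H _) (leq_trans le_mi _).
  by rewrite mdegE (bigD1 i) //= leq_addr.
exists F.
  apply: contra_neq nz_u => F0; apply/rowP => a; rewrite mxE.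
  have := congr1 (mcoeff (mn (enum_val a))) F0.
  rewrite mcoeff0 raddf_sum (bigD1 a) //= big1 => [|b neq_ba].
    by rewrite addr0 mcoeffZ mcoeffX eqxx mulr1.
  rewrite mcoeffZ mcoeffX (inj_eq mn_inj) (inj_eq enum_val_inj).
  by rewrite (negPf neq_ba) mulr0.
move=> y x nz_D eqG; apply: (mulfI (expf_neq0 (r * d) nz_D)); rewrite mulr0.
have := congr1 (meval y) sumH; rewrite meval0 => <-.
rewrite !raddf_sum mulr_sumr; apply: eq_bigr => a _.
rewrite /= !mevalZ mulrCA; congr (_ * _); rewrite mevalX rmorph_prod /=.
rewrite mulnC exprM -[X in _ ^+ X](card_ord r) -prodr_const -big_split /=.
apply: eq_bigr => j _; rewrite mnmE rmorphM !rmorphXn /= -eqG exprMn.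
by rewrite mulrAC -exprD subnKC // ltnW.
Qed.

(** * The t-adic argument on weighted power sums *)

Lemma sum_horner (R : comNzRingType) (k : nat) (p d : 'I_k -> R) (Q : {poly R}) :
  \sum_i d i * Q.[p i] = \sum_(l < size Q) Q`_l * \sum_i d i * p i ^+ l.
Proof.
under [RHS]eq_bigr => l _ do rewrite mulr_sumr.
rewrite exchange_big; apply: eq_bigr => i _.
rewrite horner_coef mulr_sumr; apply: eq_bigr => l _; exact: mulrCA.
Qed.

(** Linear combinations of the hypotheses give sum_i d_i Q(p_i) = 0 for every
    polynomial Q; taking for Q the product of the X - p_j over j != i isolates
    d_i. *)
Lemma power_sums_eq0 (R : idomainType) (k : nat) (p d : 'I_k -> R) :
  injective p -> (forall b, \sum_i d i * p i ^+ b = 0) -> forall i, d i = 0.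
Proof.
move=> p_inj pows0 i; pose Q : {poly R} := \prod_(j | j != i) ('X - (p j)%:P).
have := sum_horner p d Q; rewrite [RHS]big1 => [|l _]; last first.
  by rewrite pows0 mulr0.
rewrite (bigD1 i) //= big1 ?addr0 => [/eqP|j neq_ji].
  rewrite mulf_eq0 => /orP[/eqP //|]; rewrite horner_prod prodf_seq_eq0.
  case/hasP => j _ /andP[neq_ji]; rewrite hornerXsubC subr_eq0.
  by rewrite (inj_eq p_inj) eq_sym (negPf neq_ji).
by rewrite horner_prod (bigD1 j) //= hornerXsubC subrr mul0r mulr0.
Qed.

(** The coefficients e_l are, up to sign, those of the product of the X - p_i;
    at t = 0 this product becomes X^k. *)
Lemma power_sums_recurrence (K : fieldType) (k : nat) (p d : 'I_k -> {poly K})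
    (b : nat) :
    (forall i, (p i).[0] = 0) ->
  exists2 e : 'I_k -> {poly K}, (forall l, 'X %| e l) &
    \sum_i d i * p i ^+ (b + k) = \sum_l e l * \sum_i d i * p i ^+ (b + l).
Proof.
move=> p0; pose P : {poly {poly K}} := \prod_i ('X - (p i)%:P).
have szP : size P = k.+1 by rewrite size_prod_XsubC [index_enum _]unlock -enumT -cardT card_ord.
have monP : P`_k = 1.
  by have /monicP := monic_prod_XsubC (index_enum 'I_k) xpredT p; rewrite lead_coefE szP.
exists (fun l => - P`_l) => [l|].
  rewrite dvdpNr -['X]subr0 -polyC0 dvdp_XsubCl rootE.
  have -> : (P`_l).[0] = (map_poly (horner_eval 0) P)`_l by rewrite coef_map.
  rewrite rmorph_prod (eq_bigr (fun=> 'X)) => [|i _]; last first.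
    by rewrite rmorphB /= map_polyX map_polyC /= /horner_eval p0 subr0.
  by rewrite prodr_const card_ord coefXn ltn_eqF.
have := sum_horner p (fun i => d i * p i ^+ b) P.
rewrite big1 => [|i _]; last first.
  by rewrite horner_prod (bigD1 i) //= hornerXsubC subrr mul0r mulr0.
have expE l : \sum_i d i * p i ^+ b * p i ^+ l = \sum_i d i * p i ^+ (b + l).
  by apply: eq_bigr => i _; rewrite -mulrA -exprD.
rewrite szP big_ord_recr /= monP mul1r expE => /esym/eqP.
rewrite addrC addr_eq0 => /eqP ->; rewrite -sumrN.
by apply: eq_bigr => l _; rewrite mulNr expE.
Qed.

(** The t-adic heart of the proof: k consecutive power sums cannot all be
    combinations of later ones, unless all weights d_i are 0.  The combinations
    of the sums with index above a are written sum_i d_i p_i^(a+1) Q(p_i),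
    which avoids an explicit list of coefficients. *)
Lemma power_sums_span (K : fieldType) (k : nat) (p d : 'I_k -> {poly K}) :
    (forall i, (p i).[0] = 0) -> injective p ->
    (forall a, (a < k)%N -> exists Q : {poly {poly K}},
       \sum_i d i * p i ^+ a = \sum_i d i * p i ^+ a.+1 * Q.[p i]) ->
  forall i, d i = 0.
Proof.
move=> p0 p_inj span; apply: power_sums_eq0 p_inj _ => b.
pose u b := \sum_i d i * p i ^+ b.
have Xdvd J : forall b, 'X^J %| u b.
  elim: J => [|J IHJ] {}b; first by rewrite expr0 dvd1p.
  have high c : (k <= c)%N -> 'X^(J.+1) %| u c.
    move=> le_kc; rewrite -(subnK le_kc) /u.
    have [e Xe ->] := power_sums_recurrence d (c - k) p0.
    apply: (big_ind (fun v => 'X^(J.+1) %| v)) => [|x y|l _].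
    - exact: dvdp0.
    - exact: dvdp_add.
    by rewrite exprS dvdp_mul ?IHJ.
  (* The first k sums follow by descending induction on the index. *)
  suff low : forall n c, (k <= c + n)%N -> 'X^(J.+1) %| u c.
    exact: low (leq_addl b k).
  elim=> [|n IHn] c; first by rewrite addn0; apply: high.
  have [/high //|lt_ck le_kcn] := leqP k c.
  have [Q] := span c lt_ck; rewrite /u sum_horner => ->.
  apply: (big_ind (fun v => 'X^(J.+1) %| v)) => [|x y|l _].
  - exact: dvdp0.
  - exact: dvdp_add.
  rewrite dvdp_mull //; under eq_bigr => i _ do rewrite -mulrA -exprD.
  by apply: IHn; rewrite (leq_trans le_kcn) // addnS -addSn leq_add2r leq_addr.
apply/eqP; apply: contraT => nz_u.
by have := dvdp_leq nz_u (Xdvd (size (u b)) b); rewrite size_polyXn ltnn.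
Qed.

(** * The rank of the relation matrix *)

(** In the coordinates of a polynomial sigma without constant term, this matrix
    sends sigma to sum_i c_i sigma(p_i), truncated to degree below M.  The base
    ring is arbitrary so that c and p can also be made of indeterminates. *)
Definition comb_mx (L : comNzRingType) (k r M : nat) (c : 'I_k -> L)
    (p : 'I_k -> {poly L}) : 'M[L]_(r, M) :=
  \matrix_(j, e) (\sum_i c i *: p i ^+ j.+1)`_e.

Arguments comb_mx {L k} r M c p.

(** This is [power_sums_span] for the weights d_i = c_i p_i^(n+1), which vanish
    only if c does. *)
Lemma comb_mx_span (K : fieldType) (k r M n : nat) (c : 'I_k -> K)
    (p : 'I_k -> {poly K}) :
    (forall i, (p i).[0] = 0) -> injective p -> (forall i, p i != 0) ->
    (forall i (j : 'I_r), (size (p i ^+ j.+1) <= M)%N) ->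
    (n + k <= r)%N -> (exists i, c i != 0) ->
  exists2 a : 'I_r, (n <= a < n + k)%N &
    ~~ (row a (comb_mx r M c p)
          <= \sum_(j : 'I_r | (a < j)%N) <<row j (comb_mx r M c p)>>)%MS.
Proof.
move=> p0 p_inj p_neq0 szp le_nkr [i0 nz_c].
apply/exists_inP; apply: contraT => /exists_inPn span.
pose q (j : 'I_r) := \sum_i c i *: p i ^+ j.+1.
have szq j : (size (q j) <= M)%N.
  apply: leq_trans (size_sum _ _ _) _; apply/bigmax_leqP => i _.
  exact: leq_trans (size_scale_leq _ _) (szp i j).
pose d i := c i *: p i ^+ n.+1.
suff /(_ i0)/eqP : forall i, d i = 0.
  by rewrite scaler_eq0 (negPf nz_c) expf_eq0 (negPf (p_neq0 i0)) andbF.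
apply: power_sums_span p0 p_inj _ => a lt_ak.
have lt_nar : (n + a < r)%N by apply: leq_trans le_nkr; rewrite ltn_add2l.
pose na := Ordinal lt_nar.
have /span : (n <= na < n + k)%N by rewrite leq_addr ltn_add2l.
rewrite negbK => /sub_sumsmxP [u row_na].
have u_sub j : exists x, u j *m <<row j (comb_mx r M c p)>>%MS =
    x *: row j (comb_mx r M c p).
  apply/sub_rVP.
  by apply: submx_trans (submxMl _ _) _; rewrite genmxE.
have [s u_row] := fin_all_exists u_sub.
have q_na : q na = \sum_(j : 'I_r | (na < j)%N) s j *: q j.
  apply/polyP => e; have [le_Me|lt_eM] := leqP M e.
    rewrite nth_default ?(leq_trans (szq _)) // nth_default //.
    apply: leq_trans (size_sum _ _ _) _; apply/bigmax_leqP => j _.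
    by apply: leq_trans (size_scale_leq _ _) (leq_trans (szq j) _).
  have /rowP /(_ (Ordinal lt_eM)) := row_na.
  rewrite summxE 2!mxE => row_e; rewrite /q row_e [RHS]coef_sum; apply: eq_bigr => j _.
  by rewrite u_row !mxE coefZ.
exists (\sum_(j : 'I_r | (na < j)%N) (s j)%:P%:P * 'X^(j - na.+1)).
have dE b i : d i * p i ^+ b = c i *: p i ^+ (n + b).+1.
  by rewrite -scalerAl -exprD addSn.
under eq_bigr do rewrite dE; rewrite -[LHS]/(q na) q_na.
under [RHS]eq_bigr => i _.
  rewrite horner_sum mulr_sumr.
  under eq_bigr => j lt_naj.
    rewrite hornerCM hornerXn mulrCA dE -scalerAl -exprD mul_polyC.
    rewrite addSn addnS (subnKC lt_naj). over.
  over.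
rewrite exchange_big; apply: eq_bigr => j _.
by rewrite -scaler_sumr.
Qed.

(** The rows provided by [comb_mx_span] for the blocks of indices
    [bk, bk + k) are independent: each is outside the span of the later ones. *)
Lemma comb_mx_rank (K : fieldType) (k r M S : nat) (c : 'I_k -> K)
    (p : 'I_k -> {poly K}) :
    (forall i, (p i).[0] = 0) -> injective p -> (forall i, p i != 0) ->
    (forall i (j : 'I_r), (size (p i ^+ j.+1) <= M)%N) ->
    (k * S <= r)%N -> (exists i, c i != 0) ->
  exists f : 'I_S -> 'I_r, row_free (rowsub f (comb_mx r M c p)).
Proof.
move=> p0 p_inj p_neq0 szp le_kSr nz_c; set A := comb_mx r M c p.
have pivot (b : 'I_S) : exists a : 'I_r,
    (b * k <= a < b * k + k)%N /\
      ~~ (row a A <= \sum_(j : 'I_r | (a < j)%N) <<row j A>>)%MS.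
  have [|a] := comb_mx_span (n := b * k) p0 p_inj p_neq0 szp _ nz_c.
    by apply: leq_trans le_kSr; rewrite addnC -mulSn mulnC leq_mul2l ltn_ord orbT.
  by exists a.
have [f f_pivot] := fin_all_exists pivot; exists f.
have f_mono (b b' : 'I_S) : (b < b')%N -> (f b < f b')%N.
  move=> lt_bb'; have [/andP[_ lt_fb] _] := f_pivot b.
  have [/andP[le_fb' _] _] := f_pivot b'.
  apply: leq_trans lt_fb (leq_trans _ le_fb').
  by rewrite addnC -mulSn leq_mul2r lt_bb' orbT.
apply: inj_row_free => u uA0; apply/rowP => b; rewrite mxE.
(* The first nonzero coefficient of a relation would be that of a row in the
   span of later rows. *)
have [n] := ubnP b; elim: n b => // n IHn b; rewrite ltnS => le_bn.
apply/eqP; apply: contraT => nz_ub; have [_ /negP[]] := f_pivot b.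
have : \sum_b' u 0 b' *: row (f b') A = 0.
  rewrite -[RHS]uA0 mulmx_sum_row; apply: eq_bigr => b' _.
  by congr (_ *: _); apply/rowP => e; rewrite !mxE.
rewrite (bigD1 b) //= => /eqP; rewrite addr_eq0 => /eqP ub_row.
rewrite -(eqmx_scale _ nz_ub) ub_row eqmx_opp summx_sub // => b' neq_b'b.
have [lt_b'b|] := ltnP b' b.
  by rewrite IHn ?scale0r ?sub0mx // (leq_trans lt_b'b).
rewrite leq_eqVlt eq_sym (inj_eq val_inj) (negPf neq_b'b) => /f_mono lt_f.
by rewrite scalemx_sub // (sumsmx_sup (f b')) // genmxE.
Qed.

(** * Eliminating the parameters *)

(** The same encoding as [poly0_of_coefs], over any ring, for use with
    coefficients that are indeterminates. *)
Definition poly0_of (L : comNzRingType) (m : nat) (b : 'I_m -> L) : {poly L} :=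
  \sum_(e < m) b e *: 'X^(e.+1).
Arguments poly0_of {L m} b.

Lemma poly0_ofP (K : fieldType) (m : nat) (q : {poly K}) :
  q \in poly0_le K m -> q = poly0_of (fun e : 'I_m => q`_e.+1).
Proof.
case/andP => sz_q /eqP q0; have {1}-> : q = \poly_(i < m.+1) q`_i.
  apply/polyP => i; rewrite coef_poly; case: ltnP => // le_mi.
  by rewrite nth_default // (leq_trans sz_q).
by rewrite poly_def big_ord_recl -horner_coef0 q0 scale0r add0r.
Qed.

Lemma coef_poly0_of (K : fieldType) (m : nat) (b : 'I_m -> K) (e : 'I_m) :
  (poly0_of b)`_e.+1 = b e.
Proof.
rewrite /poly0_of coef_sum (bigD1 e) //= big1 => [|l neq_le].
  by rewrite coefZ coefXn eqxx mulr1 addr0.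
by rewrite coefZ coefXn eqSS eq_sym (inj_eq val_inj) (negPf neq_le) mulr0.
Qed.

Lemma poly0_of_mem (K : fieldType) (m : nat) (b : 'I_m -> K) :
  poly0_of b \in poly0_le K m.
Proof.
apply/andP; split.
  apply: leq_trans (size_sum _ _ _) _; apply/bigmax_leqP => e _.
  by apply: leq_trans (size_scale_leq _ _) _; rewrite size_polyXn ltnS.
rewrite horner_sum big1 // => e _.
by rewrite hornerZ hornerXn expr0n mulr0.
Qed.

Lemma map_comb_mx (L L' : comNzRingType) (phi : {rmorphism L -> L'})
    (k m r M : nat) (c : 'I_k -> L) (b : 'I_k -> 'I_m -> L)
    (c' : 'I_k -> L') (b' : 'I_k -> 'I_m -> L') :
    (forall i, phi (c i) = c' i) -> (forall i e, phi (b i e) = b' i e) ->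
  map_mx phi (comb_mx r M c (fun i => poly0_of (b i)))
    = comb_mx r M c' (fun i => poly0_of (b' i)).
Proof.
move=> phi_c phi_b; apply/matrixP => j e; rewrite !mxE -coef_map rmorph_sum.
congr ((polyseq _)`_e); apply: eq_bigr => i _.
rewrite /= map_polyZ rmorphXn /= phi_c; congr (_ *: _ ^+ _).
rewrite /poly0_of rmorph_sum; apply: eq_bigr => l _.
by rewrite /= map_polyZ map_polyXn phi_b.
Qed.

Section Elimination.

Variables (K : fieldType) (k m r M S : nat).
Variables (i0 : 'I_k) (f : 'I_S -> 'I_r) (g : 'I_S -> 'I_M).
Hypotheses (f_inj : injective f) (S_ge : (k * m.+1 <= S)%N).

(** The coordinates of sigma, of c and of the p_i, in this order. *)
Let param : finType := ('I_r + ('I_k + 'I_k * 'I_m))%type.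

(** The coordinates of sigma indexed by the image of f are solved for, and
    c_i0 is normalised to 1. *)
Definition is_free (t : param) : bool :=
  match t with
  | inl j => j \notin f @: setT
  | inr (inl i) => i != i0
  | inr (inr _) => true
  end.

Definition free_param := {t : param | is_free t}.

(** S + 1 of the r + k + km coordinates are not free, and k + km <= S. *)
Lemma card_free_param : (#|{: free_param}| < r)%N.
Proof.
pose h (o : option 'I_S) : param :=
  if o is Some l then inl (f l) else inr (inl i0).
have h_inj : injective h by move=> [l|] [l'|] //= [/f_inj ->].
have le_h : (S.+1 <= #|predC is_free|)%N.
  rewrite -[X in (X.+1 <= _)%N](card_ord S) -card_option -(card_codom h_inj).
  apply/subset_leq_card/subsetP => _ /codomP [[l|] ->] /=.
    by rewrite inE /= negbK imset_f.
  by rewrite inE /= negbK.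
have := cardC is_free; rewrite card_sig.
rewrite /param !card_sum card_prod !card_ord => cardP.
have : (#|is_free| + S.+1 <= r + S)%N.
  by apply: leq_trans (leq_add (leqnn _) le_h) _; rewrite cardP leq_add2l -mulnS.
by rewrite addnS -addSn leq_add2r.
Qed.

Let N := #|{: free_param}|.

(** Coordinates that are not free take their normalised value: 1 for c_i0, and
    0 for those of sigma that are solved for, so that they drop out of the
    right-hand side of Cramer's rule. *)
Let var (t : param) : {mpoly K[N]} :=
  if insub t is Some u then 'X_(enum_rank (u : free_param))
  else if t is inr _ then 1 else 0.

(** With w the row of the free coordinates of sigma and B the minor, the
    equation sigma A = 0 reads sigma_f B = - w A_g, whence
    (det B) sigma_f = - w A_g (adj B).  These formulas hold over the ring of
    polynomials in the free coordinates and specialise along [meval]. *)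
Lemma minor_elimination :
  exists2 F : {mpoly K[r]}, F != 0 &
    forall (c : 'I_k -> K) (b : 'I_k -> 'I_m -> K) (x : 'rV[K]_r),
      let A := comb_mx r M c (fun i => poly0_of (b i)) in
      c i0 = 1 -> x *m A = 0 -> mxsub f g A \in unitmx -> F.@[x 0] = 0.
Proof.
pose AG := comb_mx r M (fun i => var (inr (inl i)))
  (fun i => poly0_of (fun e => var (inr (inr (i, e))))).
pose BG := mxsub f g AG.
pose w : 'rV_r := \row_j var (inl j).
pose v := w *m colsub g AG *m \adj BG.
pose G j := if [pick l | f l == j] is Some l then - v 0 l else \det BG * w 0 j.
have [F nz_F FE] := mpoly_implicitization G (\det BG) card_free_param.
exists F => // c b x A c_i0 xA0 unitB.
pose value (t : param) : K :=
  match t with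
  | inl j => if j \in f @: setT then 0 else x 0 j
  | inr (inl i) => c i
  | inr (inr (i, e)) => b i e
  end.
pose y (n : 'I_N) : K := value (sval (enum_val n : free_param)).
have eval_var t : (var t).@[y] = value t.
  rewrite /var; case: insubP => [u _ <-|]; first by rewrite mevalXU /y enum_rankK.
  case: t => [j|[i|//]] /=; rewrite negbK; first by move=> ->; exact: meval0.
  by move/eqP->; rewrite meval1.
have eval_A : map_mx (meval y) AG = A.
  by apply: map_comb_mx => [i|i e]; apply: eval_var.
have eval_B : map_mx (meval y) BG = mxsub f g A by rewrite map_mxsub eval_A.
have eval_D : (\det BG).@[y] = \det (mxsub f g A) by rewrite -det_map_mx eval_B.
have eval_w : map_mx (meval y) w = \row_j value (inl j).
  by apply/rowP => j; rewrite !mxE eval_var.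
have eval_v : map_mx (meval y) v
    = - (\det (mxsub f g A) *: \row_l x 0 (f l)).
  rewrite !map_mxM map_mx_adj map_mxsub eval_A eval_B eval_w.
  apply/eqP; rewrite -addr_eq0 -mul_mx_scalar -mul_mx_adj mulmxA -mulmxDl.
  suff -> : (\row_j value (inl j)) *m colsub g A
      + (\row_l x 0 (f l)) *m mxsub f g A = 0 by rewrite mul0mx.
  apply/rowP => e; have /rowP /(_ (g e)) := xA0; rewrite !mxE => xA_ge; rewrite -[RHS]xA_ge.
  rewrite [RHS](bigID (fun j => j \in f @: setT)) /= addrC.
  congr (_ + _).
    rewrite big_imset /= => [|l l' _ _ /f_inj //].
    apply: eq_big => l; first by rewrite inE.
    by move=> _; rewrite !mxE.
  rewrite [LHS](bigID (fun j => j \in f @: setT)) /= big1 ?add0r => [|j fj].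
    by apply: eq_bigr => j nfj; rewrite !mxE /= (negPf nfj).
  by rewrite !mxE /= fj mul0r.
apply: (FE y) => [|j]; first by rewrite eval_D -unitfE -unitmxE.
rewrite eval_D /G; case: pickP => [l /eqP <-|not_fj].
  have := congr1 (fun u : 'rV__ => u 0 l) eval_v; rewrite [LHS]mxE => eval_vl.
  by rewrite mevalN [(v 0 l).@[y]]eval_vl !mxE opprK.
have := congr1 (fun u : 'rV__ => u 0 j) eval_w; rewrite [LHS]mxE [RHS]mxE => eval_wj.
rewrite mevalM eval_D [(w 0 j).@[y]]eval_wj /=.
case: imsetP => // [[l _ fl]].
by have := not_fj l; rewrite fl eqxx.
Qed.

End Elimination.

(** * The open set *)

Lemma rank_bound (m k r : nat) : (1 <= m)%N -> (1 <= k)%N ->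
    k%:R * (k%:R * (m%:R + 1) + (m%:R - 1) * (k%:R - 1) / 2%:R)
      <= r%:R :> rat ->
  (k * (k * m.+1) <= r)%N.
Proof.
move=> m_ge1 k_ge1 r_ge; rewrite -(Num.Theory.ler_nat rat).
apply: Order.POrderTheory.le_trans r_ge; rewrite !natrM -natr1.
rewrite Num.Theory.ler_wpM2l ?Num.Theory.ler0n // Num.Theory.lerDl.
by rewrite !Num.Theory.mulr_ge0 ?Num.Theory.invr_ge0 ?Num.Theory.ler0n
  ?Num.Theory.subr_ge0 ?Num.Theory.ler1n.
Qed.

Lemma row_free_minor (K : fieldType) (S r M : nat) (A : 'M[K]_(r, M))
    (f : 'I_S -> 'I_r) :
    row_free (rowsub f A) ->
  injective f /\ exists g : 'I_S -> 'I_M, mxsub f g A \in unitmx.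
Proof.
move=> free_fA; split=> [l l' eq_f|].
  have : delta_mx 0 l *m rowsub f A = delta_mx 0 l' *m rowsub f A :> 'rV_M.
    by rewrite -!rowE; apply/rowP => e; rewrite !mxE eq_f.
  move/(row_free_inj free_fA)/rowP/(_ l)/eqP; rewrite !mxE !eqxx /=.
  by case: (eqVneq l l') => // _; rewrite oner_eq0.
have full_fA : row_full (rowsub f A)^T by rewrite /row_full mxrank_tr.
exists (fullrankfun full_fA); rewrite -unitmx_tr.
have -> : (mxsub f (fullrankfun full_fA) A)^T
    = rowsub (fullrankfun full_fA) (rowsub f A)^T.
  by apply/matrixP => i j; rewrite !mxE.
exact: fullrowsub_unit.
Qed.

Unset Implicit Arguments.
Set Strict Implicit.

Theorem theorem3p5 (K : fieldType) (charK0 : [pchar K] =i pred0)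
    (m k r : nat) (m_ge1 : (1 <= m)%N) (k_ge1 : (1 <= k)%N)
    (r_ge : k%:R * (k%:R * (m%:R + 1) + (m%:R - 1) * (k%:R - 1) / 2%:R)
              <= r%:R :> rat) :
  exists U : {poly K} -> Prop,
    [/\ zariski_open_poly0 r U,
        (exists sigma : {poly K}, U sigma) &
        forall sigma : {poly K}, U sigma ->
        forall p : 'I_k -> {poly K},
          (forall i, p i \in poly0_le K m) ->
          (forall i, p i != 0) ->
          (forall i j, i != j -> p i != p j) ->
          lin_indep (fun i => sigma \Po p i)].
Proof.
have le_kSr := rank_bound m_ge1 k_ge1 r_ge.
(* The powers p_i ^ j with j <= r have degree less than M. *)
pose S := (k * m.+1)%N; pose M := (m * r).+1.
(* One relation for each normalised coordinate of c and each choice of the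
   rows and columns of the minor. *)
pose I : finType := ('I_k * ({ffun 'I_S -> 'I_r} * {ffun 'I_S -> 'I_M}))%type.
have elim_t (t : I) : exists F : {mpoly K[r]}, F != 0 /\
    (injective t.2.1 ->
     forall (c : 'I_k -> K) (b : 'I_k -> 'I_m -> K) (x : 'rV[K]_r),
      let A := comb_mx r M c (fun i => poly0_of (b i)) in
      c t.1 = 1 -> x *m A = 0 -> mxsub t.2.1 t.2.2 A \in unitmx -> F.@[x 0] = 0).
  have [/injectiveP f_inj|not_inj] := boolP (injectiveb t.2.1).
    have [F nz_F FE] := minor_elimination K t.1 t.2.2 f_inj (leqnn _).
    by exists F.
  by exists 1; rewrite oner_neq0; split=> // /injectiveP; rewrite (negPf not_inj).
have [F F_elim] := fin_all_exists elim_t.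
pose Fall := \prod_t F t.
have nz_Fall : Fall != 0 by apply/prodf_neq0 => t _; case: (F_elim t).
exists (fun s => s \in poly0_le K r /\ Fall.@[fun i : 'I_r => s`_i.+1] != 0).
have evalE (a : 'I_r -> K) :
    Fall.@[fun i : 'I_r => (poly0_of_coefs a)`_i.+1] = Fall.@[a].
  by apply: meval_eq => i; apply: coef_poly0_of.
split.
- split=> [s [] //|]; exists (eq Fall) => a; rewrite evalE; split.
    by case=> _ nz; exists Fall.
  by case=> _ <- nz; split=> //; apply: poly0_of_mem.
- have [a nz_a] := mpoly_nonroot charK0 nz_Fall.
  by exists (poly0_of_coefs a); rewrite evalE; split=> //; apply: poly0_of_mem.
move=> s [s_in nz_s] p p_in p_neq0 p_neq c sum0 i0.
apply/eqP; apply: contraNT nz_s => nz_c.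
pose c' i := (c i0)^-1 * c i.
have p0 i : (p i).[0] = 0 by have /andP[_ /eqP] := p_in i.
have p_inj : injective p.
  by move=> i j /eqP eq_p; apply/eqP; apply: contraTT eq_p => /p_neq.
have szp i (j : 'I_r) : (size (p i ^+ j.+1) <= M)%N.
  apply: leq_trans (size_poly_exp_leq _ _) _; rewrite ltnS leq_mul //.
  by have /andP[] := p_in i; rewrite -subn1 leq_subLR.
have c'_i0 : c' i0 = 1 by rewrite /c' mulVf.
have nz_c' : exists i, c' i != 0 by exists i0; rewrite c'_i0 oner_neq0.
have [f free_fA] := comb_mx_rank p0 p_inj p_neq0 szp le_kSr nz_c'.
have [f_inj [g unit_fgA]] := row_free_minor free_fA.
pose x := \row_(j < r) s`_j.+1.
pose t : I := (i0, (finfun f, finfun g)).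
have compE i : s \Po p i = \sum_(j < r) s`_j.+1 *: p i ^+ j.+1.
  rewrite {1}(poly0_ofP s_in) /poly0_of raddf_sum /=.
  by apply: eq_bigr => j _; rewrite comp_polyZ comp_Xn_poly.
have AE : comb_mx r M c' p
    = comb_mx r M c' (fun i => poly0_of (fun e : 'I_m => (p i)`_e.+1)).
  apply/matrixP => j e; rewrite !mxE; congr ((polyseq _)`_e); apply: eq_bigr => i _.
  by rewrite {1}(poly0_ofP (p_in i)).
rewrite (@meval_eq _ _ _ (x 0)) => [|i]; last by rewrite mxE.
rewrite /Fall rmorph_prod (bigD1 t) //=.
have [_ /(_ _ c' (fun i e => (p i)`_e.+1) x) ->] := F_elim t.
- by rewrite mul0r.
- by move=> l l' /=; rewrite !ffunE => /f_inj.
- exact: c'_i0.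
- rewrite -AE; apply/rowP => e; rewrite !mxE.
  have := congr1 (fun q : {poly K} => ((c i0)^-1 *: q)`_e) sum0.
  rewrite scaler0 coef0 => sum0_e; rewrite -[RHS]sum0_e.
  rewrite scaler_sumr; under [in RHS]eq_bigr do
    rewrite scalerA -/(c' _) compE scaler_sumr.
  rewrite exchange_big coef_sum; apply: eq_bigr => j _.
  rewrite !mxE -coefZ scaler_sumr; congr ((polyseq _)`_e); apply: eq_bigr => i _.
  by rewrite !scalerA mulrC.
rewrite -AE /=.
have -> : mxsub (finfun f) (finfun g) (comb_mx r M c' p)
    = mxsub f g (comb_mx r M c' p).
  by apply/matrixP => l e; rewrite !mxE !ffunE.
exact: unit_fgA.
Qed.
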